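(* Let $N$ be a nonzero rational number and let $(X,Y)$ and $(Z,W)$ be two different nontrivial rational solutions (i.e. with $Y\neq 0$, $W\neq 0$) of the congruent number equation $C_N:\ y^2=x^3-N^2x$, such that the product $XZ$ is a square of a rational number. Then, for an arbitrary positive rational $a$, the numbers $$b=\frac{|YW|}{2XZN}\cdot a,\quad c=\frac{|X-Z|}{2\sqrt{XZ}}\cdot a,\quad d_{bc}=\frac{|N^2-XZ|}{2N\sqrt{XZ}}\cdot a,\quad d_{ac}=\frac{|X+Z|}{2\sqrt{XZ}}\cdot a,\quad d_s=\frac{N^2+XZ}{2N\sqrt{XZ}}\cdot a$$ give a nearly-perfect cuboid with sides $a,b,c$, face diagonals $d_{bc}=\sqrt{b^2+c^2}$, $d_{ac}=\sqrt{a^2+c^2}$ and space diagonal $d_s=\sqrt{a^2+b^2+c^2}$ all rational, and this parametrization is complete: every nearly-perfect cuboid (rational $a,b,c,d_{bc},d_{ac},d_s$, with only the face diagonal $d_{ab}=\sqrt{a^2+b^2}$ possibly irrational) arises in this way for some $N$ and some such pair of solutions of $C_N$. Consequently, a perfect cuboid exists if and only if, for some such $N$ and some such pair of solutions $(X,Y),(Z,W)$ of $C_N$ with $XZ$ a square, the number $$d_{ab}=\sqrt{1+\Big(\frac{YW}{2NXZ}\Big)^2}\cdot a$$ is rational.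
   Context: A perfect cuboid (PC) is a rectangular parallelepiped with rational sides $a,b,c$, rational face diagonals $d_{ab}=\sqrt{a^2+b^2}$, $d_{bc}=\sqrt{b^2+c^2}$, $d_{ac}=\sqrt{a^2+c^2}$ and rational space diagonal $d_s=\sqrt{a^2+b^2+c^2}$. A nearly-perfect cuboid (NPC) is one in which, of these seven quantities, only the face diagonal $d_{ab}$ may be irrational. The congruent number equation (congruent curve) is $C_N:\ y^2=x^3-N^2x$; its nontrivial rational solutions are those with $y\neq 0$. Infinitely many pairs of solutions with $XZ$ a square exist on any $C_N$ with a nontrivial point $P$: e.g. the $x$-coordinates of $kP$ and $mP$ with $k,m$ of the same parity.
   Formalization: ''Two different solutions'' is taken to mean X ≠ Z, since (X,Y),(X,−Y) gives c = 0 and always rational d_ab; and for N < 0, where the displayed b, d_bc, d_s are negative, the first claim is stated with their absolute values (verbatim for N > 0). *)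

(* Defs.v *)
From mathcomp Require Import all_boot all_order all_algebra.
From mathcomp Require Import boolp classical_sets reals.

Set Implicit Arguments.
Unset Strict Implicit.
Unset Printing Implicit Defensive.

Import Order.TTheory GRing.Theory Num.Theory.
Local Open Scope ring_scope.

Definition face_diagonal (R : realType) (x y : R) : R :=
  Num.sqrt (x ^+ 2 + y ^+ 2).

Definition space_diagonal (R : realType) (x y z : R) : R :=
  Num.sqrt (x ^+ 2 + y ^+ 2 + z ^+ 2).

(* The face diagonal of the sides a and b is the unconstrained one. *)
Definition nearly_perfect_cuboid (R : realType) (a b c : R) : Prop :=
  [/\ 0 < a, 0 < b & 0 < c] /\
  [/\ rational a, rational b & rational c] /\
  [/\ rational (face_diagonal b c), rational (face_diagonal a c)
    & rational (space_diagonal a b c)].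

Definition perfect_cuboid (R : realType) (a b c : R) : Prop :=
  [/\ 0 < a, 0 < b & 0 < c] /\
  [/\ rational a, rational b & rational c] /\
  [/\ rational (face_diagonal a b), rational (face_diagonal b c),
      rational (face_diagonal a c) & rational (space_diagonal a b c)].

Definition nontrivial_solution (R : realType) (N x y : R) : Prop :=
  [/\ rational x, rational y, y ^+ 2 = x ^+ 3 - N ^+ 2 * x & y != 0].

(* The solutions are required to differ in their x-coordinates: the pair
   (x, y), (x, -y) would give a side c of length 0. *)
Definition admissible_pair (R : realType) (N X Y Z W : R) : Prop :=
  [/\ nontrivial_solution N X Y, nontrivial_solution N Z W, X != Z
    & exists2 r : R, rational r & X * Z = r ^+ 2].

Section Parametrization.
Variable R : realType.
Implicit Types N X Y Z W a : R.

Definition param_b N X Y Z W a : R := `|Y * W| / (2 * X * Z * N) * a.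
Definition param_c X Z a : R := `|X - Z| / (2 * Num.sqrt (X * Z)) * a.
Definition param_dbc N X Z a : R :=
  `|N ^+ 2 - X * Z| / (2 * N * Num.sqrt (X * Z)) * a.
Definition param_dac X Z a : R := `|X + Z| / (2 * Num.sqrt (X * Z)) * a.
Definition param_ds N X Z a : R :=
  (N ^+ 2 + X * Z) / (2 * N * Num.sqrt (X * Z)) * a.
Definition param_dab N X Y Z W a : R :=
  Num.sqrt (1 + (Y * W / (2 * N * X * Z)) ^+ 2) * a.

End Parametrization.

Definition npc_with_diagonals (R : realType) (a b c dbc dac ds : R) : Prop :=
  nearly_perfect_cuboid a b c /\
  [/\ dbc = face_diagonal b c, dac = face_diagonal a c
    & ds = space_diagonal a b c].

(* Main.v *)
Require Import Defs.
From mathcomp Require Import all_boot all_order all_algebra.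
From mathcomp Require Import boolp classical_sets reals.
From mathcomp Require Import ring lra.

Import Order.TTheory GRing.Theory Num.Theory.
Local Open Scope ring_scope.

(** With [s = sqrt (X Z)], the curve equations give
    [(Y W)^2 = s^2 (X^2 - N^2) (Z^2 - N^2)], which makes every diagonal formula
    an identity between squares. Conversely, a nearly-perfect cuboid determines
    the ratios [p = (dac + c) / a], with inverse [(dac - c) / a], and
    [q = (ds + dbc) / a], with inverse [(ds - dbc) / a], which have to be [X / s]
    and [N / s] up to sign. Since
    [(p^2 - q^2) (p^-2 - q^2) = (2 q b / a)^2], the scale [u = p (p^2 - q^2)]
    makes both [X^3 - N^2 X] and [Z^3 - N^2 Z] rational squares for
    [X = u p], [Z = u / p], [N = |u| q]. *)

(** * Closure of the rational reals under the field operations and absolute value *)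

Section RationalClosure.
Variable R : realType.
Implicit Types x y : R.

Lemma rationalD x y : rational x -> rational y -> rational (x + y).
Proof. by move=> [p _ <-] [q _ <-]; exists (p + q); rewrite ?rmorphD. Qed.

Lemma rationalN x : rational x -> rational (- x).
Proof. by move=> [p _ <-]; exists (- p); rewrite ?rmorphN. Qed.

Lemma rationalB x y : rational x -> rational y -> rational (x - y).
Proof. by move=> rx ry; apply/rationalD/rationalN. Qed.

Lemma rationalM x y : rational x -> rational y -> rational (x * y).
Proof. by move=> [p _ <-] [q _ <-]; exists (p * q); rewrite ?rmorphM. Qed.

Lemma rationalV x : rational x -> rational x^-1.
Proof. by move=> [p _ <-]; exists p^-1; rewrite ?fmorphV. Qed.

Lemma rational_div x y : rational x -> rational y -> rational (x / y).
Proof. by move=> rx ry; apply/rationalM/rationalV. Qed.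

Lemma rationalX x n : rational x -> rational (x ^+ n).
Proof. by move=> [p _ <-]; exists (p ^+ n); rewrite ?rmorphXn. Qed.

Lemma rational_nat n : rational (n%:R : R).
Proof. by exists n%:R; rewrite ?ratr_nat. Qed.

Lemma rational_norm x : rational x -> rational `|x|.
Proof. by move=> [p _ <-]; exists `|p|; rewrite ?ratr_norm. Qed.

End RationalClosure.

(** * Diagonals and their squares *)

Section Diagonals.
Variable R : realType.
Implicit Types a b c d : R.

Lemma sqr_norm_real a : `|a| ^+ 2 = a ^+ 2.
Proof. by rewrite real_normK ?num_real. Qed.

Lemma face_diagonalE b c d :
  b ^+ 2 + c ^+ 2 = d ^+ 2 -> face_diagonal b c = `|d|.
Proof. by rewrite /face_diagonal => ->; rewrite sqrtr_sqr. Qed.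

Lemma space_diagonalE a b c d :
  a ^+ 2 + b ^+ 2 + c ^+ 2 = d ^+ 2 -> space_diagonal a b c = `|d|.
Proof. by rewrite /space_diagonal => ->; rewrite sqrtr_sqr. Qed.

Lemma face_diagonal_sqr a b : face_diagonal a b ^+ 2 = a ^+ 2 + b ^+ 2.
Proof. by rewrite sqr_sqrtr ?addr_ge0 ?sqr_ge0. Qed.

Lemma space_diagonal_sqr a b c :
  space_diagonal a b c ^+ 2 = a ^+ 2 + b ^+ 2 + c ^+ 2.
Proof. by rewrite sqr_sqrtr ?addr_ge0 ?sqr_ge0. Qed.

End Diagonals.

(** * From a pair of solutions to a cuboid *)

Section AdmissibleToCuboid.
Variables (R : realType) (N X Y Z W : R).
Hypotheses (rN : rational N) (N0 : N != 0) (adm : admissible_pair N X Y Z W).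

Let s := Num.sqrt (X * Z).

Lemma solution_x_neq0 (x y : R) : nontrivial_solution N x y -> x != 0.
Proof.
move=> [_ _ e]; apply: contraNneq => x0; move: e.
by rewrite x0 expr0n mulr0 subr0 => /eqP; rewrite sqrf_eq0.
Qed.

Let X0 : X != 0. Proof. by case: adm => /solution_x_neq0. Qed.
Let Z0 : Z != 0. Proof. by case: adm => _ /solution_x_neq0. Qed.

(** A square is nonnegative, and this one is nonzero since a nontrivial solution has nonzero
    abscissa. *)
Lemma admissible_mul_gt0 : 0 < X * Z.
Proof.
case: adm => _ _ _ [r _ e].
by rewrite lt_def mulf_neq0 // e sqr_ge0.
Qed.

Lemma admissible_sqrt_gt0 : 0 < s.
Proof. by rewrite sqrtr_gt0 admissible_mul_gt0. Qed.

Lemma admissible_sqrt_sqr : s ^+ 2 = X * Z.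
Proof. by rewrite sqr_sqrtr // ltW // admissible_mul_gt0. Qed.

Lemma admissible_sqrt_rational : rational s.
Proof.
case: adm => _ _ _ [r rr e].
by rewrite /s e sqrtr_sqr; apply: rational_norm.
Qed.

(** [Y] and [W] enter only through their squares, which the curve equations eliminate; one factor
    [X * Z] then cancels. *)
Lemma param_b_sqr a : param_b N X Y Z W a ^+ 2 =
  (X ^+ 2 - N ^+ 2) * (Z ^+ 2 - N ^+ 2) / (4 * (X * Z) * N ^+ 2) * a ^+ 2.
Proof.
case: adm => -[_ _ eY _] [_ _ eW _] _ _.
rewrite /param_b 2!exprMn sqr_norm_real exprMn eY eW.
by field; rewrite X0 Z0 N0.
Qed.

Lemma param_c_sqr a :
  param_c X Z a ^+ 2 = (X - Z) ^+ 2 / (4 * (X * Z)) * a ^+ 2.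
Proof.
rewrite /param_c 2!exprMn sqr_norm_real -/s exprVn exprMn admissible_sqrt_sqr.
by field; rewrite X0 Z0.
Qed.

Lemma param_dac_sqr a :
  param_dac X Z a ^+ 2 = (X + Z) ^+ 2 / (4 * (X * Z)) * a ^+ 2.
Proof.
rewrite /param_dac 2!exprMn sqr_norm_real -/s exprVn exprMn admissible_sqrt_sqr.
by field; rewrite X0 Z0.
Qed.

Lemma param_dbc_sqr a : param_dbc N X Z a ^+ 2 =
  (N ^+ 2 - X * Z) ^+ 2 / (4 * N ^+ 2 * (X * Z)) * a ^+ 2.
Proof.
rewrite /param_dbc 2!exprMn sqr_norm_real -/s exprVn exprMn admissible_sqrt_sqr.
by field; rewrite X0 Z0 N0.
Qed.

Lemma param_ds_sqr a : param_ds N X Z a ^+ 2 =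
  (N ^+ 2 + X * Z) ^+ 2 / (4 * N ^+ 2 * (X * Z)) * a ^+ 2.
Proof.
rewrite /param_ds 2!exprMn -/s exprVn exprMn admissible_sqrt_sqr.
by field; rewrite X0 Z0 N0.
Qed.

(** Rests on [(X^2 - N^2) (Z^2 - N^2) + N^2 (X - Z)^2 = (N^2 - X Z)^2]. *)
Lemma param_face_bc a :
  face_diagonal (param_b N X Y Z W a) (param_c X Z a) = `|param_dbc N X Z a|.
Proof.
apply: face_diagonalE; rewrite param_b_sqr param_c_sqr param_dbc_sqr.
by field; rewrite X0 Z0 N0.
Qed.

Lemma param_face_ac a : face_diagonal a (param_c X Z a) = `|param_dac X Z a|.
Proof.
apply: face_diagonalE; rewrite param_c_sqr param_dac_sqr.
by field; rewrite X0 Z0.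
Qed.

(** With [b^2 + c^2 = dbc^2], this reduces to [4 N^2 X Z + (N^2 - X Z)^2 = (N^2 + X Z)^2]. *)
Lemma param_space a :
  space_diagonal a (param_b N X Y Z W a) (param_c X Z a) = `|param_ds N X Z a|.
Proof.
apply: space_diagonalE; rewrite param_b_sqr param_c_sqr param_ds_sqr.
by field; rewrite X0 Z0 N0.
Qed.

Lemma param_face_ab a : 0 <= a ->
  param_dab N X Y Z W a = face_diagonal a (param_b N X Y Z W a).
Proof.
(* Since [a] is nonnegative it equals the root of [a ^+ 2], so it can be moved under the root. *)
move=> a0; rewrite /param_dab -[X in _ * X](ger0_norm a0) -sqrtr_sqr.
rewrite -sqrtrM ?addr_ge0 ?sqr_ge0 // /face_diagonal /param_b.
rewrite [(`|_| / _ * a) ^+ 2]exprMn [(`|_| / _) ^+ 2]exprMn sqr_norm_real.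
congr Num.sqrt.
by field; rewrite X0 Z0 N0.
Qed.

(** The absolute values absorb the sign of [N]; they leave the squares, hence the diagonals,
    unchanged. *)
Lemma param_npc a : rational a -> 0 < a ->
  npc_with_diagonals a `|param_b N X Y Z W a| (param_c X Z a)
    `|param_dbc N X Z a| (param_dac X Z a) `|param_ds N X Z a|.
Proof.
move=> ra a0; have a_neq0 := lt0r_neq0 a0.
case: (adm) => -[rX rY _ Y0] [rZ rW _ W0] XZ _.
have rs := admissible_sqrt_rational.
have r2 := rational_nat R 2.
have ebc : face_diagonal `|param_b N X Y Z W a| (param_c X Z a)
           = `|param_dbc N X Z a|.
  by rewrite -param_face_bc /face_diagonal sqr_norm_real.
have eac : face_diagonal a (param_c X Z a) = param_dac X Z a.
  rewrite param_face_ac ger0_norm // /param_dac.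
  by rewrite mulr_ge0 ?divr_ge0 ?mulr_ge0 ?sqrtr_ge0 // ltW.
have eabc : space_diagonal a `|param_b N X Y Z W a| (param_c X Z a)
            = `|param_ds N X Z a|.
  by rewrite -param_space /space_diagonal sqr_norm_real.
split; last by [].
split; first split=> //.
- by rewrite normr_gt0 !mulf_neq0 ?invr_neq0 ?normr_eq0 ?mulf_neq0 ?pnatr_eq0.
(* Positivity of [c] is where [X != Z] enters. *)
- rewrite mulr_gt0 ?divr_gt0 ?normr_gt0 ?subr_eq0 //.
  by rewrite mulr_gt0 // admissible_sqrt_gt0.
rewrite ebc eac eabc; split; split=> //.
- apply/rational_norm/rationalM/ra/rational_div.
    exact/rational_norm/rationalM.
  exact/rationalM/rN/rationalM/rZ/rationalM.
- apply/rationalM/ra/rational_div; first exact/rational_norm/rationalB.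
  exact: rationalM.
- apply/rational_norm/rationalM/ra/rational_div.
    by apply/rational_norm/rationalB; [apply: rationalX | apply: rationalM].
  by apply/rationalM/rs/rationalM.
- apply/rationalM/ra/rational_div; first exact/rational_norm/rationalD.
  exact: rationalM.
apply/rational_norm/rationalM/ra/rational_div.
  by apply/rationalD; [apply: rationalX | apply: rationalM].
by apply/rationalM/rs/rationalM.
Qed.

Lemma param_npc_gt0 a : rational a -> 0 < a -> 0 < N ->
  npc_with_diagonals a (param_b N X Y Z W a) (param_c X Z a)
    (param_dbc N X Z a) (param_dac X Z a) (param_ds N X Z a).
Proof.
move=> ra a0 Np; have XZp := admissible_mul_gt0; have sp := admissible_sqrt_gt0.
have b_ge0 : 0 <= param_b N X Y Z W a.
  by rewrite mulr_ge0 ?divr_ge0 // ltW // -(mulrA 2) 2?mulr_gt0.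
have dbc_ge0 : 0 <= param_dbc N X Z a.
  by rewrite mulr_ge0 ?divr_ge0 // ltW // !mulr_gt0.
have ds_ge0 : 0 <= param_ds N X Z a.
  by rewrite mulr_ge0 ?divr_ge0 ?ltW // ?addr_gt0 ?exprn_gt0 // !mulr_gt0.
by move: (param_npc a ra a0); rewrite !ger0_norm.
Qed.

End AdmissibleToCuboid.

(** * From a cuboid to a pair of solutions *)

Section CuboidToAdmissible.
Variable R : realType.

Lemma npc_complete (a b c : R) : nearly_perfect_cuboid a b c ->
  exists N X Y Z W : R,
    [/\ rational N, N != 0 & admissible_pair N X Y Z W] /\
    [/\ b = param_b N X Y Z W a, c = param_c X Z a,
        face_diagonal b c = param_dbc N X Z a,
        face_diagonal a c = param_dac X Z a
      & space_diagonal a b c = param_ds N X Z a].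
Proof.
case=> -[a0 b0 c0] [[ra rb rc] []].
have := face_diagonal_sqr R b c; have := face_diagonal_sqr R a c.
have := space_diagonal_sqr R a b c.
have: 0 <= face_diagonal b c := sqrtr_ge0 _.
have: 0 <= face_diagonal a c := sqrtr_ge0 _.
have: 0 <= space_diagonal a b c := sqrtr_ge0 _.
move: (face_diagonal b c) (face_diagonal a c) (space_diagonal a b c).
move=> dbc dac ds ds_ge0 dac_ge0 dbc_ge0 eds edac edbc rdbc rdac rds.
have a_neq0 := lt0r_neq0 a0.
pose p := (dac + c) / a; pose q := (ds + dbc) / a.
have ds0 : 0 < ds by rewrite lt_def ds_ge0 andbT -sqrf_eq0 eds; nra.
have p0 : 0 < p by rewrite divr_gt0 // ltr_wpDl.
have q0 : 0 < q by rewrite divr_gt0 // ltr_wpDr.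
have p_neq0 := lt0r_neq0 p0; have q_neq0 := lt0r_neq0 q0.
(* Both inverses come from a difference of squares: [dac^2 - c^2] and [ds^2 - dbc^2] equal [a^2]. *)
have pV : p^-1 = (dac - c) / a.
  apply: (mulfI p_neq0); rewrite divff // /p.
  have -> : (dac + c) / a * ((dac - c) / a) = (dac ^+ 2 - c ^+ 2) / a ^+ 2.
    by field.
  by rewrite edac; field.
have qV : q^-1 = (ds - dbc) / a.
  apply: (mulfI q_neq0); rewrite divff // /q.
  have -> : (ds + dbc) / a * ((ds - dbc) / a) = (ds ^+ 2 - dbc ^+ 2) / a ^+ 2.
    by field.
  by rewrite eds edbc; field.
have ec : c = (p - p^-1) / 2 * a by rewrite pV /p; field.
have eac : dac = (p + p^-1) / 2 * a by rewrite pV /p; field.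
have ebc : dbc = (q - q^-1) / 2 * a by rewrite qV /q; field.
have es : ds = (q + q^-1) / 2 * a by rewrite qV /q; field.
have rp : rational p by apply/rational_div/ra/rationalD.
have rq : rational q by apply/rational_div/ra/rationalD.
clearbody p q.
(* The left side is [q^2 ((q + q^-1)^2 - (p + p^-1)^2)], that is [4 q^2 (ds^2 - dac^2) / a^2]. *)
have key : (p ^+ 2 - q ^+ 2) * (p^-1 ^+ 2 - q ^+ 2) = (2 * q * b / a) ^+ 2.
  have -> : (2 * q * b / a) ^+ 2 = 4 * q ^+ 2 / a ^+ 2 * b ^+ 2 by field.
  have -> : b ^+ 2 = ds ^+ 2 - dac ^+ 2 by rewrite eds edac; ring.
  by rewrite es eac; field; rewrite p_neq0 q_neq0.
have w0 : 2 * q * b / a != 0.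
  by rewrite lt0r_neq0 // divr_gt0 // !mulr_gt0.
pose u := p * (p ^+ 2 - q ^+ 2).
have u0 : u != 0.
  rewrite mulf_neq0 //; apply: contra_neq w0 => e.
  by apply/eqP; rewrite -sqrf_eq0 -key e mul0r.
have ru : rational u by apply/rationalM/rationalB; rewrite //; apply: rationalX.
have nu0 : `|u| != 0 by rewrite normr_eq0.
have XZ : u * p * (u / p) = u ^+ 2 by field.
have sXZ : Num.sqrt (u * p * (u / p)) = `|u| by rewrite XZ sqrtr_sqr.
(* The choice of [u] gives [X^3 - N^2 X = u^3 p (p^2 - q^2) = u^4], so [Y = u^2]; likewise
   [Z^3 - N^2 Z] is [u^2] times the left side of [key], which gives [W]. As [u] may be negative,
   [|u|] keeps [N] positive and matches [sqrt (X Z)]. *)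
exists (`|u| * q), (u * p), (u ^+ 2), (u / p), (u * (2 * q * b / a)).
split; first split.
- exact/rationalM/rq/rational_norm.
- exact: mulf_neq0.
- split; last by exists u.
  + split; [exact: rationalM | exact: rationalX | | by rewrite sqrf_eq0].
    rewrite [(`|u| * q) ^+ 2]exprMn sqr_norm_real.
    by rewrite /u; ring.
  + split; [exact: rational_div | | | exact: mulf_neq0].
      apply/rationalM/rational_div => //.
      by apply/rationalM/rb/rationalM/rq/rational_nat.
    rewrite [(`|u| * q) ^+ 2]exprMn sqr_norm_real exprMn -key.
    by rewrite /u; field.
  (* [X = Z] would force [p = p^-1], whereas [p - p^-1 = 2 c / a] is positive. *)
  + rewrite (inj_eq (mulfI u0)) gt_eqF // -subr_gt0.
    by move: c0; rewrite ec pmulr_lgt0 // pmulr_lgt0 // invr_gt0.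
(* These signs remove the absolute values in the formulas for [c] and [dbc]. *)
have pV0 : 0 <= p - p^-1.
  by move: (ltW c0); rewrite ec pmulr_lge0 // pmulr_lge0 // invr_gt0.
have qV0 : 0 <= q - q^-1.
  by move: dbc_ge0; rewrite ebc pmulr_lge0 // pmulr_lge0 // invr_gt0.
have nu2 : u ^+ 2 = `|u| ^+ 2 by rewrite sqr_norm_real.
rewrite /param_b /param_c /param_dbc /param_dac /param_ds sXZ XZ.
rewrite -(mulrA 2 (u * p)) XZ; split.
- have -> : `|u ^+ 2 * (u * (2 * q * b / a))| = `|u| ^+ 3 * (2 * q * b / a).
    rewrite normrM normrX (normrM u) [`|_ / a|]gtr0_norm; first by ring.
    by rewrite divr_gt0 // !mulr_gt0.
  by rewrite nu2; field; rewrite nu0 q_neq0.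
- by rewrite -mulrBr normrM (ger0_norm pV0) {1}ec; field; rewrite nu0.
- have -> : (`|u| * q) ^+ 2 - u ^+ 2 = u ^+ 2 * q * (q - q^-1).
    by rewrite nu2; field.
  rewrite 2!normrM normrX (ger0_norm qV0) (gtr0_norm q0) {1}ebc.
  by field; rewrite nu0 q_neq0.
- rewrite -mulrDr normrM [`|p + _|]gtr0_norm ?addr_gt0 ?invr_gt0 // {1}eac.
  by field; rewrite nu0.
- by rewrite nu2 {1}es; field; rewrite nu0 q_neq0.
Qed.

End CuboidToAdmissible.

(* C_N depends only on N ^+ 2, whereas the formulas for b, dbc and ds change
   sign with N: they are lengths as they stand for 0 < N, and up to sign for
   an arbitrary N != 0. *)
Theorem theorem6 (R : realType) :
  (forall N X Y Z W a : R,
     rational N -> N != 0 -> admissible_pair N X Y Z W ->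
     rational a -> 0 < a ->
     [/\ 0 < N ->
         npc_with_diagonals a (param_b N X Y Z W a) (param_c X Z a)
           (param_dbc N X Z a) (param_dac X Z a) (param_ds N X Z a),
         npc_with_diagonals a `|param_b N X Y Z W a| (param_c X Z a)
           `|param_dbc N X Z a| (param_dac X Z a) `|param_ds N X Z a|
       & param_dab N X Y Z W a = face_diagonal a (param_b N X Y Z W a)]) /\
  (forall a b c : R, nearly_perfect_cuboid a b c ->
     exists N X Y Z W : R,
       [/\ rational N, N != 0 & admissible_pair N X Y Z W] /\
       [/\ b = param_b N X Y Z W a, c = param_c X Z a,
           face_diagonal b c = param_dbc N X Z a,
           face_diagonal a c = param_dac X Z a
         & space_diagonal a b c = param_ds N X Z a]) /\
  (forall a : R, rational a -> 0 < a ->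
     (exists x y z : R, perfect_cuboid x y z) <->
     (exists N X Y Z W : R,
        [/\ rational N, N != 0, admissible_pair N X Y Z W
          & rational (param_dab N X Y Z W a)])).
Proof.
split; [|split].
- move=> N X Y Z W a rN N0 adm ra a0; split.
  + exact: param_npc_gt0.
  + exact: param_npc.
  + by apply: param_face_ab (ltW a0).
- exact: npc_complete.
move=> a ra a0; split.
  move=> [x [y [z [[x0 y0 z0] [[rx ry rz] [rxy ryz rxz rxyz]]]]]].
  have [|N [X [Y [Z [W [[rN N0 adm] [eb _ _ _ _]]]]]]] := @npc_complete R x y z.
    by [].
  exists N, X, Y, Z, W; split=> //.
  (* [param_dab] is linear in the scale, so rationality at the side [x] of the given cuboid
     transfers to the prescribed [a]. *)
  have -> : param_dab N X Y Z W a = param_dab N X Y Z W x / x * a.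
    by rewrite /param_dab mulfK // lt0r_neq0.
  rewrite (param_face_ab _ _ _ _ _ _ N0 adm) // ?ltW // -eb.
  exact/rationalM/ra/rational_div.
move=> [N [X [Y [Z [W [rN N0 adm rd]]]]]].
have [[pos [rats [rbc rac rabc]]] _] := param_npc _ _ _ _ _ _ rN N0 adm a ra a0.
(* [N] may be negative, so the side is the absolute value; the diagonal [d_ab] sees only its
   square. *)
exists a, `|param_b N X Y Z W a|, (param_c X Z a).
do 2!split=> //; split=> //.
by rewrite /face_diagonal sqr_norm_real -/(face_diagonal _ _) -param_face_ab ?ltW.
Qed.
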